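(* Let $Q(x)=\sum_{k\geq0}op_{[2^k]}(123)x^{2k}$. Then \[Q(x)=\sqrt{\frac{2}{1+2x^2+\sqrt{1-12x^2}}}.\]
   Context: An ordered partition of $[n]=\{1,\dots,n\}$ is a sequence $B_1/\cdots/B_k$ of nonempty pairwise disjoint subsets of $[n]$ with union $[n]$. It contains the pattern $123$ if there are indices $i_1<i_2<i_3$ and elements $b_j\in B_{i_j}$ with $b_1<b_2<b_3$; otherwise it avoids $123$. $op_{[2^k]}(123)$ is the number of $123$-avoiding ordered partitions of $[2k]$ with $k$ blocks each of size $2$ (with $op_{[2^0]}(123)=1$). *)

(* Defs.v *)
From HB Require Import structures.
From mathcomp Require Import all_boot all_order all_algebra.
From mathcomp Require Import boolp.

Set Implicit Arguments.
Unset Strict Implicit.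
Unset Printing Implicit Defensive.

Import GRing.Theory.

(* The ground set [n] = {1, ..., n} is represented by 'I_n = {0, ..., n - 1};
   the shift by one preserves the order. *)
Definition ordered_partition (n k : nat) (B : {ffun 'I_k -> {set 'I_n}}) : bool :=
  [&& [forall i, B i != set0],
      [forall i, forall j, (i != j) ==> [disjoint B i & B j]]
    & \bigcup_i B i == [set: 'I_n]].

Definition contains123 (n k : nat) (B : {ffun 'I_k -> {set 'I_n}}) : bool :=
  [exists i1 : 'I_k, exists i2 : 'I_k, exists i3 : 'I_k,
   exists b1 : 'I_n, exists b2 : 'I_n, exists b3 : 'I_n,
     [&& i1 < i2, i2 < i3, b1 \in B i1, b2 \in B i2, b3 \in B i3,
         b1 < b2 & b2 < b3]].

Definition op2_123 (k : nat) : nat :=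
  #|[set B : {ffun 'I_k -> {set 'I_(2 * k)}} |
      [&& ordered_partition B, [forall i, #|B i| == 2] & ~~ contains123 B]]|.

Local Open Scope ring_scope.

(* Formal power series, as a record so that they do not inherit the pointwise
   ring structure of functions. *)
Record fps (R : Type) := Fps { fps_coef : nat -> R }.

Coercion fps_coef : fps >-> Funclass.

HB.instance Definition _ (R : Type) := gen_eqMixin (fps R).
HB.instance Definition _ (R : Type) := gen_choiceMixin (fps R).

Lemma fpsP (R : Type) (f g : fps R) : (forall n, f n = g n) <-> f = g.
Proof.
split=> [|-> //]; case: f g => [f] [g] /= fg.
by congr Fps; apply/funext.
Qed.

Section FpsRing.
Variable R : comNzRingType.
Implicit Types f g h : fps R.

Definition fps_zero : fps R := Fps (fun=> 0).
Definition fps_one : fps R := Fps (fun n => (n == 0%N)%:R).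
Definition fps_opp f := Fps (fun n => - f n).
Definition fps_add f g := Fps (fun n => f n + g n).
Definition fps_mul f g := Fps (fun n => \sum_(i < n.+1) f i * g (n - i)%N).

Fact fps_addA : associative fps_add.
Proof. by move=> f g h; apply/fpsP => n /=; rewrite addrA. Qed.

Fact fps_addC : commutative fps_add.
Proof. by move=> f g; apply/fpsP => n /=; rewrite addrC. Qed.

Fact fps_add0 : left_id fps_zero fps_add.
Proof. by move=> f; apply/fpsP => n /=; rewrite add0r. Qed.

Fact fps_addN : left_inverse fps_zero fps_opp fps_add.
Proof. by move=> f; apply/fpsP => n /=; rewrite addNr. Qed.

HB.instance Definition _ :=
  GRing.isZmodule.Build (fps R) fps_addA fps_addC fps_add0 fps_addN.

Let trunc n f : {poly R} := \poly_(i < n.+1) f i.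

Let coef_trunc n f i : (i <= n)%N -> (trunc n f)`_i = f i.
Proof. by move=> le_in; rewrite coef_poly ltnS le_in. Qed.

Let fps_mul_trunc n f g i :
  (i <= n)%N -> (fps_mul f g) i = (trunc n f * trunc n g)`_i.
Proof.
move=> le_in; rewrite coefM /=; apply: eq_bigr => j _.
have le_ji : (j <= i)%N by rewrite -ltnS.
by rewrite !coef_trunc // ?(leq_trans _ le_in) // leq_subr.
Qed.

Fact fps_mulC : commutative fps_mul.
Proof.
by move=> f g; apply/fpsP => n; rewrite !(@fps_mul_trunc n) // mulrC.
Qed.

Fact fps_mulA : associative fps_mul.
Proof.
move=> f g h; apply/fpsP => n.
transitivity ((trunc n f * (trunc n g * trunc n h))`_n).
  rewrite coefM /=; apply: eq_bigr => i _; have le_in : (i <= n)%N by rewrite -ltnS.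
  by rewrite coef_trunc // -(@fps_mul_trunc n) // leq_subr.
rewrite mulrA coefM /=; apply: eq_bigr => i _.
have le_in : (i <= n)%N by rewrite -ltnS.
by rewrite coef_trunc ?leq_subr // -(@fps_mul_trunc n).
Qed.

Fact fps_mul1 : left_id fps_one fps_mul.
Proof.
move=> f; apply/fpsP => n /=; rewrite big_ord_recl /= mul1r subn0.
by rewrite big1 ?addr0 // => i _; rewrite mul0r.
Qed.

Fact fps_mulDl : left_distributive fps_mul fps_add.
Proof.
move=> f g h; apply/fpsP => n /=; rewrite -big_split /=.
by apply: eq_bigr => i _; rewrite mulrDl.
Qed.

Fact fps_one_neq0 : fps_one != 0.
Proof.
by apply/eqP => /fpsP /(_ 0%N); apply/eqP; rewrite /= oner_eq0.
Qed.

HB.instance Definition _ := GRing.Zmodule_isComNzRing.Build (fps R)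
  fps_mulA fps_mulC fps_mul1 fps_mulDl fps_one_neq0.

Definition fpsX : fps R := Fps (fun n => (n == 1%N)%:R).

Lemma fpsE :
  (forall n, (0 : fps R) n = 0) *
  (forall n, (1 : fps R) n = (n == 0%N)%:R) *
  (forall f n, (- f) n = - f n) *
  (forall f g n, (f + g) n = f n + g n) *
  (forall f g n, (f * g) n = \sum_(i < n.+1) f i * g (n - i)%N).
Proof. by []. Qed.

End FpsRing.

Arguments fpsX {R}.

Section CourseOfValues.
Variable R : nmodType.
Variable step : nat -> seq R -> R.

Fixpoint fps_prefix n : seq R :=
  if n is m.+1 then rcons (fps_prefix m) (step m (fps_prefix m)) else [::].

(* The series whose coefficient at n is step n [:: c_0; ...; c_(n-1)]. *)
Definition fps_rec : fps R := Fps (fun n => step n (fps_prefix n)).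

Lemma fps_prefixE n : fps_prefix n = mkseq (fps_coef fps_rec) n.
Proof. by elim: n => //= n IHn; rewrite mkseqS -IHn. Qed.

Lemma fps_recE n : fps_rec n = step n (mkseq (fps_coef fps_rec) n).
Proof. by rewrite -fps_prefixE. Qed.

End CourseOfValues.

Section FpsField.
Variable F : fieldType.
Implicit Types f g : fps F.

Definition fps_unit : pred (fps F) := fun f => f 0%N != 0.

Definition fps_inv f : fps F :=
  if fps_unit f then
    fps_rec (fun n c => (f 0%N)^-1 *
      ((n == 0%N)%:R - \sum_(i < n) f i.+1 * c`_(n - i.+1)))
  else f.

Fact fps_mulV : {in fps_unit, left_inverse 1 fps_inv *%R}.
Proof.
move=> f; rewrite unfold_in => fU; rewrite mulrC /fps_inv /fps_unit fU.
apply/fpsP => n; rewrite !fpsE big_ord_recl subn0 [X in _ * X]fps_recE mulVKf //.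
rewrite -addrA [X in _ + X](_ : _ = 0) ?addr0 //.
apply/eqP; rewrite addrC subr_eq0; apply/eqP/eq_bigr => i _.
by rewrite nth_mkseq // ltn_subrL (leq_ltn_trans _ (ltn_ord i)).
Qed.

Fact fps_unitP f g : g * f = 1 -> fps_unit f.
Proof.
move/fpsP/(_ 0%N); rewrite !fpsE big_ord1 subnn /= => gf.
by apply/eqP => f0; move/eqP: gf; rewrite f0 mulr0 eq_sym oner_eq0.
Qed.

Fact fps_inv_out : {in [predC fps_unit], fps_inv =1 id}.
Proof. by move=> f; rewrite inE unfold_in /fps_inv /fps_unit => /negbTE ->. Qed.

HB.instance Definition _ := GRing.ComNzRing_hasMulInverse.Build (fps F)
  fps_mulV fps_unitP fps_inv_out.

(* The square root with constant coefficient 1 of a series f with constant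
   coefficient 1, in characteristic different from 2; see sqr_fps_sqrt and
   fps_sqrt_uniq. Other series f get a junk value. *)
Definition fps_sqrt f : fps F :=
  fps_rec (fun n c =>
    if n == 0%N then 1 else (f n - \sum_(1 <= i < n) c`_i * c`_(n - i)) / 2).

Let coef_sqrS g n : g 0%N = 1 ->
  (g ^+ 2) n.+1 = g n.+1 * 2 + \sum_(1 <= i < n.+1) g i * g (n.+1 - i)%N.
Proof.
move=> g0; rewrite expr2 fpsE big_ord_recl big_ord_recr /=.
rewrite /bump /= add1n subn0 subnn g0 mul1r mulr1 mulr_natr mulr2n addrCA addrC.
by rewrite big_add1 /= big_mkord.
Qed.

Lemma fps_sqrt0 f : (fps_sqrt f) 0%N = 1.
Proof. by []. Qed.

Let fps_sqrtS f n : (fps_sqrt f) n.+1 =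
  (f n.+1 - \sum_(1 <= i < n.+1) (fps_sqrt f) i * (fps_sqrt f) (n.+1 - i)%N) / 2.
Proof.
rewrite {1}/fps_sqrt fps_recE /=; congr ((_ - _) / _).
apply: eq_big_nat => i /andP[i0 lt_in]; rewrite !nth_mkseq //.
by rewrite ltn_subrL i0.
Qed.

Lemma sqr_fps_sqrt f : 2 != 0 :> F -> f 0%N = 1 -> fps_sqrt f ^+ 2 = f.
Proof.
move=> nz2 f0; apply/fpsP => -[|n].
  by rewrite expr2 fpsE big_ord1 subnn fps_sqrt0 mulr1 f0.
by rewrite coef_sqrS // fps_sqrtS mulfVK // subrK.
Qed.

Lemma fps_sqrt_uniq f g :
  2 != 0 :> F -> g 0%N = 1 -> g ^+ 2 = f -> g = fps_sqrt f.
Proof.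
move=> nz2 g0 <-; apply/fpsP => n; elim/ltn_ind: n => -[|n] IHn.
  by rewrite fps_sqrt0.
rewrite fps_sqrtS coef_sqrS //.
rewrite [X in _ + X - _](_ : _ = \sum_(1 <= i < n.+1)
   (fps_sqrt (g ^+ 2)) i * (fps_sqrt (g ^+ 2)) (n.+1 - i)%N).
  by rewrite addrK mulfK.
apply: eq_big_nat => i /andP[i0 lt_in].
by rewrite !IHn // ltn_subrL i0.
Qed.

End FpsField.

(* The series \sum_(k >= 0) op2_123 k * x ^ (2 k). *)
Definition Q : fps rat :=
  Fps (fun n => if odd n then 0 else (op2_123 n./2)%:R).

(* Main.v *)
(* Reading off the block of each element turns the partitions into words in
   which every letter 0, ..., k - 1 occurs twice, with 123-avoidance preserved.
   Let m be the length of the longest weakly decreasing prefix of such a word.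
   The largest letter k may be inserted twice exactly at positions
   i <= j <= m, and the new word has statistic i if i > 0, j + 1 if
   i = 0 < j, and m + 2 if i = j = 0. With A_k(u) the sum of u ^ m over the
   words, this gives
     (u - 1)^2 A_(k+1)(u) =
       u^2 (u^2 - u + 1) A_k(u) - u (u - 1) A_k'(1) - u^3 A_k(1).
   Put x = X^2. The kernel (u - 1)^2 = x u^2 (u^2 - u + 1) becomes
   w^2 = x (1 - w) for u = 1 / (1 - s) and w = s (1 - s). On its zeros the
   recurrence yields s w = x (w D + Q), where D is the sum of the
   A_k'(1) x^k. The two roots satisfy w1 + w2 = w1 w2 = - x; eliminating D
   leaves Q (1 - s1 - s2) = 1, and
   1 - s1 - s2 = (sqrt (1 - 4 w1) + sqrt (1 - 4 w2)) / 2. *)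

Require Import Defs.
From mathcomp Require Import all_boot all_order all_algebra.
From mathcomp Require Import zify ring.

Set Implicit Arguments.
Unset Strict Implicit.
Unset Printing Implicit Defensive.

Import GRing.Theory.

(** * Weakly decreasing prefixes and insertion of two equal letters *)

Fixpoint dec_run (x : nat) (s : seq nat) : nat :=
  if s is y :: t then (if y <= x then (dec_run y t).+1 else 0) else 0.

Definition dec_prefix (w : seq nat) : nat :=
  if w is x :: t then (dec_run x t).+1 else 0.

Lemma path_take_dec_run x s j :
  j <= size s -> path geq x (take j s) = (j <= dec_run x s).
Proof.
elim: s x j => [|y s IHs] x [|j] //= le_js.
by rewrite IHs //; case: (y <= x).
Qed.

Lemma sorted_take_dec_prefix w j :
  j <= size w -> sorted geq (take j w) = (j <= dec_prefix w).
Proof. by case: w j => [|x s] [|j] //= le_js; rewrite path_take_dec_run. Qed.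

Lemma dec_run_size x s : dec_run x s <= size s.
Proof. by elim: s x => //= y s IHs x; case: (y <= x); rewrite ?ltnS ?IHs. Qed.

Lemma dec_prefix_size w : dec_prefix w <= size w.
Proof. by case: w => //= x s; rewrite ltnS dec_run_size. Qed.

Lemma dec_run_cat x p k r :
  path geq x p -> last x p < k -> dec_run x (p ++ k :: r) = size p.
Proof.
elim: p x => [|y p IHp] x /=; first by rewrite ltnNge => _ /negPf ->.
by case/andP=> -> yp lt_k; rewrite IHp.
Qed.

(** Both positions refer to the old word: for [i <= j <= size w] the copies of [k] occupy positions
    [i] and [j.+1] of the new one. *)
Definition insert2 (k : nat) (w : seq nat) (i j : nat) : seq nat :=
  take i w ++ k :: drop i (take j w) ++ k :: drop j w.

(** A [k] right after an old letter ends the prefix, since old letters are smaller; copies at the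
    very front only lengthen it. *)
Lemma dec_prefix_insert2 k w i j :
  all (ltn^~ k) w -> i <= j -> j <= dec_prefix w ->
  dec_prefix (insert2 k w i j) =
    if 0 < i then i else if 0 < j then j.+1 else (dec_prefix w).+2.
Proof.
move=> /allP w_lt_k le_ij le_jm.
have le_jw := leq_trans le_jm (dec_prefix_size w).
have w_sorted : sorted geq (take j w) by rewrite sorted_take_dec_prefix.
rewrite /insert2; case: i le_ij => [|i] le_ij /=.
  rewrite take0 drop0 /=; case: j le_ij le_jm le_jw w_sorted => [|j] _ le_jm le_jw.
    rewrite take0 drop0 /= leqnn => _; congr _.+2.
    by case: w w_lt_k {le_jm le_jw} => //= x s w_lt_k; rewrite ltnW ?w_lt_k ?mem_head.
  case: w w_lt_k le_jm le_jw => //= x s w_lt_k _ le_js x_path.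
  rewrite ltnW ?w_lt_k ?mem_head // dec_run_cat //; last first.
    apply: w_lt_k; have := mem_last x (take j s); rewrite !inE.
    by case/orP=> [->|/mem_take ->] //; rewrite orbT.
  by rewrite size_takel.
have i_sorted : sorted geq (take i.+1 w).
  by rewrite sorted_take_dec_prefix ?(leq_trans le_ij).
case: w w_lt_k le_jm le_jw i_sorted {w_sorted} => [|x s] w_lt_k le_jm /= le_jw.
  by case: j le_ij le_jm le_jw.
move=> x_path; rewrite dec_run_cat //; last first.
  apply: w_lt_k; have := mem_last x (take i s); rewrite !inE.
  by case/orP=> [->|/mem_take ->] //; rewrite orbT.
by rewrite size_takel //; apply: (leq_trans le_ij le_jw).
Qed.

(** * Generation of the words by insertion *)

Definition insertions (k : nat) (w : seq nat) : seq (seq nat) :=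
  [seq insert2 k w i j | j <- iota 0 (dec_prefix w).+1, i <- iota 0 j.+1].

Fixpoint words (k : nat) : seq (seq nat) :=
  if k is k'.+1 then flatten [seq insertions k' w | w <- words k'] else [:: [::]].

Lemma insertionsP k w v :
  reflect (exists i j, [/\ i <= j, j <= dec_prefix w & v = insert2 k w i j])
          (v \in insertions k w).
Proof.
apply: (iffP allpairsPdep) => [[j [i [+ + ->]]]|[i [j [le_ij le_jm ->]]]].
  by rewrite !mem_iota !add0n !ltnS => ? ?; exists i, j.
by exists j, i; rewrite !mem_iota !add0n !ltnS.
Qed.

Lemma count_insert2 k w i j a : i <= j ->
  count a (insert2 k w i j) = count a w + (a k).*2.
Proof.
move=> le_ij; rewrite -[in RHS](cat_take_drop j w) -[in RHS](cat_take_drop i (take j w)).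
by rewrite take_takel // /insert2 count_cat /= count_cat /= !count_cat; lia.
Qed.

(** Erasing [k] undoes the insertion, so distinct parents have no common child. *)
Lemma filter_insert2 k w i j : i <= j -> k \notin w ->
  filter (predC1 k) (insert2 k w i j) = w.
Proof.
move=> le_ij kNw; rewrite /insert2 filter_cat /= eqxx /=.
rewrite filter_cat /= eqxx /= catA -filter_cat -[take i w](take_takel w le_ij).
rewrite cat_take_drop -filter_cat cat_take_drop.
apply/all_filterP/allP => x xw /=; apply: contraNneq kNw => <- //.
Qed.

(** The first [k] sits at position [i]; once the common beginning is cancelled, the next one sits at
    [j - i]. *)
Lemma insert2_inj k w i j i' j' : k \notin w ->
  i <= j -> j <= size w -> i' <= j' -> j' <= size w ->
  insert2 k w i j = insert2 k w i' j' -> i = i' /\ j = j'.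
Proof.
move=> kNw le_ij le_jw le_ij' le_jw'.
have index_cat_k p r : k \notin p -> index k (p ++ k :: r) = size p.
  by move=> kNp; rewrite index_cat (negPf kNp) /= eqxx addn0.
have kNt n : k \notin take n w by apply: contra kNw => /mem_take.
have kNdt n m : k \notin drop n (take m w).
  by apply: contra kNw => /mem_drop/mem_take.
rewrite /insert2 => eq_ins.
have eq_i : i = i'.
  have := congr1 (index k) eq_ins; rewrite !index_cat_k //.
  by rewrite !size_takel ?(leq_trans le_ij) ?(leq_trans le_ij').
split=> //; move: eq_ins; rewrite -eq_i => /eqP; rewrite eqseq_cat // eqxx /=.
rewrite eqseq_cons eqxx /= => /eqP /(congr1 (index k)); rewrite !index_cat_k //.
by rewrite !size_drop !size_takel //; lia.
Qed.

(** * Avoidance of 123 under insertion *)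

Definition avoids (w : seq nat) : Prop :=
  forall x y z, x < y -> y < z -> ~~ subseq [:: x; y; z] w.

(** The boolean counts as 0 or 1, so letters from [k] on are excluded as well. *)
Definition doubled (k : nat) (w : seq nat) : Prop :=
  forall i, count_mem i w = (i < k).*2.

Lemma doubled_lt k w : doubled k w -> all (ltn^~ k) w.
Proof.
move=> wk; apply/allP=> x; rewrite -has_pred1 has_count wk /=.
by case: (x < k).
Qed.

Lemma doubled_notin k w : doubled k w -> k \notin w.
Proof. by move=> wk; rewrite -has_pred1 has_count wk ltnn. Qed.

(** The displayed [k] is the last one, so a match of [rcons s k] uses up [s] inside [t]. Reversal
    puts that [k] in front, where [subseq] matches greedily. *)
Lemma subseq_rcons_last (k : nat) s t r : k \notin r ->
  subseq (rcons s k) (t ++ k :: r) -> subseq s t.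
Proof.
move=> kNr; rewrite -subseq_rev rev_rcons rev_cat rev_cons cat_rcons -[subseq s t]subseq_rev.
have: k \notin rev r by rewrite mem_rev.
elim: (rev r) => [|y r' IHr] /=; first by rewrite eqxx.
by rewrite inE negb_or => /andP[/negPf -> kNr']; apply: IHr.
Qed.

Lemma sorted_geq_subseq2 x y (s : seq nat) :
  sorted geq s -> subseq [:: x; y] s -> y <= x.
Proof.
move=> s_sorted /(subseq_sorted (rev_trans leq_trans)) /(_ s_sorted) /=.
by rewrite andbT.
Qed.

Lemma no_subseq2_sorted_geq (s : seq nat) :
  (forall x y, x < y -> ~~ subseq [:: x; y] s) -> sorted geq s.
Proof.
elim: s => // a [|b s] IHs //= no12; apply/andP; split.
  rewrite leqNgt; apply/negP => /no12 /negP; apply.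
  by rewrite /= !eqxx sub0seq.
apply: IHs => x y /no12; apply: contra => sub.
exact: subseq_trans sub (subseq_cons _ _).
Qed.

(** A new pattern must use [k] as its 3, and its 12 then lies before the second copy, that is, in
    [take j w]. *)
Lemma avoids_insert2 k w i j : all (ltn^~ k) w -> i <= j -> j <= size w ->
  avoids (insert2 k w i j) <-> avoids w /\ sorted geq (take j w).
Proof.
move=> w_lt_k le_ij le_jw.
have kNw : k \notin w by apply/negP=> /(allP w_lt_k); rewrite /= ltnn.
have wE := filter_insert2 le_ij kNw.
have sub_w s : k \notin s -> subseq s (insert2 k w i j) = subseq s w.
  move=> kNs; rewrite -[in RHS]wE subseq_filter (_ : all _ s) //.
  by apply/allP=> x xs /=; apply: contraNneq kNs => <-.
have ins_take : filter (predC1 k) (take i w ++ k :: drop i (take j w)) = take j w.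
  rewrite filter_cat /= eqxx /= -filter_cat -[take i w](take_takel w le_ij) cat_take_drop.
  apply/all_filterP/allP => x /mem_take xw /=; apply: contraNneq kNw => <- //.
have insE : insert2 k w i j = (take i w ++ k :: drop i (take j w)) ++ k :: drop j w.
  by rewrite /insert2 -catA.
split=> [av|[av tj_sorted] x y z lt_xy lt_yz].
  split=> [x y z lt_xy lt_yz|].
    apply: contra (av _ _ _ lt_xy lt_yz) => sub.
    rewrite sub_w //; apply: contra kNw => /(mem_subseq sub) //.
  apply: no_subseq2_sorted_geq => x y lt_xy; apply/negP => sub.
  have lt_yk : y < k.
    by apply: (allP w_lt_k); apply: (mem_take (n0 := j)); apply: (mem_subseq sub); rewrite !inE eqxx orbT.
  case/negP: (av _ _ _ lt_xy lt_yk); rewrite insE -[[:: x; y; k]]/([:: x; y] ++ [:: k]).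
  rewrite cat_subseq ?sub1seq ?mem_head //.
  by have := sub; rewrite -{1}ins_take subseq_filter => /andP[].
apply/negP => sub.
(* No letter exceeds [k], so in [x < y < z] only [z] can be an inserted letter. *)
have lt_zk : z <= k.
  have: z \in insert2 k w i j by apply: (mem_subseq sub); rewrite !inE eqxx !orbT.
  rewrite /insert2 !(mem_cat, inE).
  case/or3P => [/mem_take/(allP w_lt_k)/ltnW|/eqP->|] //.
  case/or3P => [/mem_drop/mem_take/(allP w_lt_k)/ltnW|/eqP->|/mem_drop/(allP w_lt_k)/ltnW] //.
have lt_yk := leq_trans lt_yz lt_zk; have lt_xk := ltn_trans lt_xy lt_yk.
case: (eqVneq z k) => [eq_zk|ne_zk].
  move: sub; rewrite eq_zk insE -[[:: x; y; k]]/(rcons [:: x; y] k) => /subseq_rcons_last sub.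
  have {}sub : subseq [:: x; y] (take j w).
    rewrite -ins_take subseq_filter sub /=; last by apply: contra kNw => /mem_drop.
    by rewrite (ltn_eqF lt_xk) (ltn_eqF lt_yk).
  by have := sorted_geq_subseq2 tj_sorted sub; rewrite leqNgt lt_xy.
case/negP: (av _ _ _ lt_xy lt_yz); rewrite -sub_w // !inE.
by rewrite (gtn_eqF lt_xk) (gtn_eqF lt_yk) eq_sym (negPf ne_zk).
Qed.

Lemma split_first (k : nat) v : k \in v ->
  exists p r, v = p ++ k :: r /\ k \notin p.
Proof.
elim: v => // a v IHv; rewrite inE; case: eqVneq => [-> _|ne_ka /IHv [p [r [-> kNp]]]].
  by exists [::], v.
by exists (a :: p), r; rewrite inE negb_or ne_ka.
Qed.

Lemma insert2_surj (k : nat) v : count_mem k v = 2 ->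
  exists w i j, [/\ i <= j, j <= size w, k \notin w & v = insert2 k w i j].
Proof.
move=> v2; have kv : k \in v by rewrite -has_pred1 has_count v2.
have [p [s [eq_v kNp]]] := split_first kv.
have count0 t : k \notin t -> count_mem k t = 0 by move/count_memPn.
have s1 : count_mem k s = 1.
  by move: v2; rewrite eq_v count_cat /= eqxx count0 // => -[].
have ks : k \in s by rewrite -has_pred1 has_count s1.
have [q [r [eq_s kNq]]] := split_first ks.
have kNr : k \notin r.
  by apply/count_memPn; move: s1; rewrite eq_s count_cat /= eqxx count0 // => -[].
(* The pieces before, between and after the two copies of [k]; the second position does not count
   the first copy. *)
exists (p ++ q ++ r), (size p), (size p + size q); split.
- exact: leq_addr.
- by rewrite !size_cat addnA leq_addr.
- by rewrite !mem_cat !negb_or kNp kNq.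
rewrite eq_v eq_s /insert2 take_size_cat // catA -size_cat take_size_cat //.
by rewrite !drop_size_cat.
Qed.

(** Each such word comes from the one without its largest letter, and [sorted_take_dec_prefix] turns
    the sortedness condition of [avoids_insert2] into the bound on [j] in [insertions]. *)
Lemma mem_words k w : w \in words k <-> doubled k w /\ avoids w.
Proof.
elim: k w => [|k IHk] v /=.
  rewrite inE; split=> [/eqP ->|[v0 _]]; first by split.
  by case: v v0 => // a v /(_ a); rewrite /= eqxx.
split=> [/flatten_mapP [w /IHk [wk w_av] /insertionsP [i [j [le_ij le_jm ->]]]]|[vk v_av]].
  have le_jw := leq_trans le_jm (dec_prefix_size w).
  split; last by apply/(avoids_insert2 (doubled_lt wk) le_ij le_jw);
    rewrite sorted_take_dec_prefix.
  by move=> a; rewrite count_insert2 // wk /= eq_sym; lia.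
have [w [i [j [le_ij le_jw kNw eq_v]]]] :
    exists w i j, [/\ i <= j, j <= size w, k \notin w & v = insert2 k w i j].
  by apply: insert2_surj; rewrite vk ltnSn.
have wk : doubled k w.
  move=> a; have := vk a; rewrite eq_v count_insert2 //= eq_sym.
  case: (eqVneq a k) => [->|ne_ak]; last by lia.
  by move/count_memPn: kNw => ->; rewrite ltnn.
move: v_av; rewrite eq_v => /(avoids_insert2 (doubled_lt wk) le_ij le_jw) [w_av w_sorted].
apply/flatten_mapP; exists w; first exact/IHk.
by apply/insertionsP; exists i, j; rewrite -sorted_take_dec_prefix.
Qed.

Lemma uniq_insertions k w : k \notin w -> uniq (insertions k w).
Proof.
move=> kNw; apply: allpairs_uniq_dep => [|j _|]; rewrite ?iota_uniq //.
move=> _ _ /allpairsPdep [j [i [+ + ->]]] /allpairsPdep [j' [i' [+ + ->]]] /=.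
rewrite !mem_iota !add0n !ltnS /= => le_jm le_ij le_jm' le_ij' eq_ins.
have sz := dec_prefix_size w.
by have [-> ->] := insert2_inj kNw le_ij (leq_trans le_jm sz) le_ij' (leq_trans le_jm' sz) eq_ins.
Qed.

Lemma uniq_words k : uniq (words k).
Proof.
elim: k => //= k IHk.
have kN w : w \in words k -> k \notin w by move/mem_words => [/doubled_notin].
(* Generalised to sublists of [words k], so that list induction applies. *)
suff gen ws : uniq ws -> {subset ws <= words k} ->
    uniq (flatten [seq insertions k w | w <- ws]) by apply: gen.
elim: ws {IHk} => // w ws IHws /andP[wNws ws_uniq] sub.
rewrite -[flatten _]/(insertions k w ++ flatten [seq insertions k v | v <- ws]).
rewrite cat_uniq uniq_insertions ?kN ?sub ?mem_head //.
rewrite IHws // ?andbT => [|v vws]; last by rewrite sub // inE vws orbT.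
apply/hasPn => v /flatten_mapP [w' w'ws /insertionsP [i' [j' [le_ij' _ ->]]]].
apply/negP => /insertionsP [i [j [le_ij _ eq_ins]]].
case/negP: wNws; rewrite -(filter_insert2 le_ij (kN _ (sub _ (mem_head _ _)))) -eq_ins.
by rewrite filter_insert2 // kN // sub // inE w'ws orbT.
Qed.

Lemma size_word k w : w \in words k -> size w = 2 * k.
Proof.
elim: k w => [|k IHk] w /=; first by rewrite inE => /eqP ->.
case/flatten_mapP => v /IHk sz_v /insertionsP [i [j [le_ij _ ->]]].
by rewrite -(count_predT (insert2 _ _ _ _)) count_insert2 // count_predT sz_v /=; lia.
Qed.

(** * Words as ordered partitions *)

Lemma subseq_consP (x : nat) s w :
  subseq (x :: s) w <->
  exists p, [/\ p < size w, nth 0 w p = x & subseq s (drop p.+1 w)].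
Proof.
split=> [|[p [lt_pw <- sub]]]; last first.
  apply: (subseq_trans _ (drop_subseq w p)).
  by rewrite (drop_nth 0) //= eqxx.
elim: w => //= y w IHw; case: eqVneq => [-> sub|_ /IHw [p [lt_pw eq_x sub]]].
  by exists 0; rewrite drop0.
by exists p.+1.
Qed.

Lemma subseq3_nth w :
  (exists x y z, [/\ x < y, y < z & subseq [:: x; y; z] w]) <->
  (exists p q r, [/\ p < q, q < r, r < size w,
     nth 0 w p < nth 0 w q & nth 0 w q < nth 0 w r]).
Proof.
split=> [[x [y [z [lt_xy lt_yz]]]]|[p [q [r [lt_pq lt_qr lt_rw lt_xy lt_yz]]]]].
  case/subseq_consP => p [_ eq_x /subseq_consP [q [_ eq_y /subseq_consP [r [lt_r eq_z _]]]]].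
  (* Each position given by [subseq_consP] counts from just after the previous one. *)
  exists p, (p.+1 + q), (p.+1 + q.+1 + r).
  move: lt_xy lt_yz; rewrite -eq_x -eq_y -eq_z !nth_drop addnA => -> ->.
  by move: lt_r; rewrite !size_drop; split; lia.
exists (nth 0 w p), (nth 0 w q), (nth 0 w r); split=> //.
apply/subseq_consP; exists p; split=> //; first by lia.
apply/subseq_consP; exists (q - p.+1).
rewrite nth_drop size_drop subnKC //; split=> //; first by lia.
apply/subseq_consP; exists (r - q.+1); rewrite drop_drop.
have -> : (q - p.+1).+1 + p.+1 = q.+1 by lia.
by rewrite nth_drop size_drop subnKC // sub0seq; split=> //; lia.
Qed.

Definition blocks (k : nat) (w : seq nat) : {ffun 'I_k -> {set 'I_(2 * k)}} :=
  [ffun i : 'I_k => [set j : 'I_(2 * k) | nth 0 w j == i]].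

Lemma card_block k w (i : 'I_k) : size w = 2 * k ->
  #|blocks k w i| = count_mem (i : nat) w.
Proof.
move=> sz_w; rewrite ffunE -sum1_card -sum1_count (big_nth 0) sz_w big_mkord.
by apply: eq_bigl => j; rewrite inE.
Qed.

Lemma nth_word_lt k w (j : 'I_(2 * k)) : w \in words k -> nth 0 w j < k.
Proof.
move=> w_k; have [/doubled_lt /allP w_lt _] := (mem_words k w).1 w_k.
by apply: w_lt; apply: mem_nth; rewrite (size_word w_k).
Qed.

Lemma blocks_inj k : {in words k &, injective (@blocks k)}.
Proof.
move=> v w v_k w_k eq_vw; apply: (@eq_from_nth _ 0).
  by rewrite (size_word v_k) (size_word w_k).
rewrite (size_word v_k) => j lt_j.
have /ffunP/(_ (Ordinal (nth_word_lt (Ordinal lt_j) v_k))) := eq_vw.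
rewrite !ffunE => /setP /(_ (Ordinal lt_j)).
by rewrite !inE /= eqxx => /esym /eqP.
Qed.

(** Elements become positions and block indices become letters, so both sides ask for increasing
    letters at increasing positions. *)
Lemma contains123_blocks k w : size w = 2 * k -> all (ltn^~ k) w ->
  reflect (exists x y z, [/\ x < y, y < z & subseq [:: x; y; z] w])
          (contains123 (blocks k w)).
Proof.
move=> sz_w /allP w_lt; apply: (iffP idP) => [|/subseq3_nth].
  case/existsP=> i1 /existsP[i2] /existsP[i3] /existsP[p] /existsP[q] /existsP[r].
  rewrite !ffunE !inE => /and5P[lt12 lt23 /eqP eq1 /eqP eq2 /and3P[/eqP eq3 lt_pq lt_qr]].
  by apply/subseq3_nth; exists p, q, r; rewrite eq1 eq2 eq3 sz_w.
case=> p [q [r [lt_pq lt_qr]]]; rewrite sz_w => lt_r lt12 lt23.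
have lt_q := ltn_trans lt_qr lt_r; have lt_p := ltn_trans lt_pq lt_q.
have w_k s : s < 2 * k -> nth 0 w s < k.
  by move=> lt_s; apply: w_lt; rewrite mem_nth ?sz_w.
apply/existsP; exists (Ordinal (w_k _ lt_p)); apply/existsP; exists (Ordinal (w_k _ lt_q)).
apply/existsP; exists (Ordinal (w_k _ lt_r)).
apply/existsP; exists (Ordinal lt_p); apply/existsP; exists (Ordinal lt_q).
apply/existsP; exists (Ordinal lt_r).
by rewrite !ffunE !inE /= !eqxx lt12 lt23 lt_pq lt_qr.
Qed.

(** The default [0] is never reached when the blocks cover the ground set. *)
Definition word_of (k : nat) (B : {ffun 'I_k -> {set 'I_(2 * k)}}) : seq nat :=
  [seq (if [pick i | j \in B i] is Some i then val i else 0) | j <- enum 'I_(2 * k)].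

Lemma blocks_word_of k (B : {ffun 'I_k -> {set 'I_(2 * k)}}) :
  ordered_partition B ->
  [/\ size (word_of B) = 2 * k, all (ltn^~ k) (word_of B) & blocks k (word_of B) = B].
Proof.
case/and3P=> _ /forallP disj /eqP cov.
have sz : size (word_of B) = 2 * k by rewrite size_map size_enum_ord.
have blockP j : exists2 i : 'I_k, j \in B i & nth 0 (word_of B) j = i.
  rewrite /word_of (nth_map j) ?size_enum_ord // nth_ord_enum.
  case: pickP => [i Bij|noB]; first by exists i.
  have: j \in \bigcup_i B i by rewrite cov inE.
  by case/bigcupP=> i _; rewrite noB.
split=> //.
  apply/allP=> x /(nthP 0) [j]; rewrite sz => lt_j <-.
  by have [i _ /= ->] := blockP (Ordinal lt_j).
apply/ffunP=> i; rewrite ffunE; apply/setP=> j; rewrite inE.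
(* Disjointness forces the picked block [i'] to be the only one containing [j]. *)
have [i' Bi'j ->] := blockP j; apply/eqP/idP => [/val_inj <- //|Bij].
apply/eqP; apply: contraTT Bij => ne_i.
have /forallP/(_ i)/implyP/(_ ne_i) := disj i'.
by move/pred0P/(_ j); rewrite /= Bi'j /= => ->.
Qed.

(** [blocks k] is injective on [words k], and [word_of] supplies preimages for all counted
    partitions. *)
Lemma op2_123_words k : op2_123 k = size (words k).
Proof.
rewrite -(size_map (@blocks k)) -(card_uniqP _); last first.
  by rewrite map_inj_in_uniq ?uniq_words //; apply: blocks_inj.
apply: eq_card => B; rewrite inE; apply/and3P/mapP => [[partB cardB avB]|[w w_k ->]].
  have [sz w_lt eqB] := blocks_word_of partB.
  exists (word_of B) => //; apply/mem_words; split=> [i|x y z lt_xy lt_yz].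
    case: (ltnP i k) => [lt_ik|le_ki].
      by rewrite -(card_block (Ordinal lt_ik)) // eqB (eqP (forallP cardB _)).
    by apply/count_memPn/negP => /(allP w_lt); rewrite /= ltnNge le_ki.
  apply: contra avB => sub; rewrite -eqB.
  by apply/contains123_blocks => //; exists x, y, z.
have sz := size_word w_k; have [wk w_av] := (mem_words k w).1 w_k.
have cardB (i : 'I_k) : #|blocks k w i| = 2 by rewrite card_block // wk ltn_ord.
split; first 1 last.
- by apply/forallP=> i; rewrite cardB.
- apply/(contains123_blocks sz (doubled_lt wk)) => -[x [y [z [lt_xy lt_yz]]]].
  exact/negP/w_av.
apply/and3P; split.
- by apply/forallP=> i; rewrite -card_gt0 cardB.
- apply/forallP=> i; apply/forallP=> i'; apply/implyP; apply: contraNT.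
  case/pred0Pn=> j; rewrite /= !ffunE !inE => /andP[/eqP eq_i /eqP eq_i'].
  by rewrite -val_eqE /= -eq_i -eq_i'.
apply/eqP/setP=> j; rewrite inE; apply/bigcupP.
by exists (Ordinal (nth_word_lt j w_k)); rewrite // ffunE inE.
Qed.

Local Open Scope ring_scope.

(** * The recurrence for the prefix statistic *)

Section Transfer.
Variables (R : comNzRingType) (u : R).

(** This is [A_k(u)], over any commutative ring so that [u] may be a power series. *)
Definition prefix_enum (k : nat) : R := \sum_(w <- words k) u ^+ dec_prefix w.

Lemma sum_insertions k w : all (ltn^~ k) w ->
  \sum_(v <- insertions k w) u ^+ dec_prefix v =
  u ^+ (dec_prefix w).+2 +
  \sum_(j < dec_prefix w) (u ^+ j.+2 + \sum_(i < j.+1) u ^+ i.+1).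
Proof.
move=> w_lt; rewrite /insertions big_allpairs_dep.
rewrite -[iota 0 _]/(index_iota 0 (dec_prefix w).+1) big_mkord.
transitivity (\sum_(j < (dec_prefix w).+1) \sum_(i < j.+1)
   u ^+ (if 0 < i then i : nat else if 0 < j then j.+1 else (dec_prefix w).+2)%N).
  apply: eq_bigr => j _; rewrite -[iota 0 _]/(index_iota 0 j.+1) big_mkord.
  by apply: eq_bigr => i _; rewrite dec_prefix_insert2 // -ltnS.
(* The term [j = 0] has both copies in front; in the others [j] shifts by one and [i = 0] is split
   off. *)
rewrite big_ord_recl big_ord1 /=; congr (_ + _); apply: eq_bigr => j _.
by rewrite big_ord_recl /=.
Qed.

(** The square clears two nested geometric sums without division. The term [- u] of the inner sum,
    occurring [m] times, yields the part in [m%:R] that becomes [A_k'(1)]. *)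
Lemma kernel_sum m :
  (u - 1) ^+ 2 * (u ^+ m.+2 + \sum_(j < m) (u ^+ j.+2 + \sum_(i < j.+1) u ^+ i.+1)) =
  u ^+ 2 * (u ^+ 2 - u + 1) * u ^+ m - u * (u - 1) * m%:R - u ^+ 3.
Proof.
have geo n : (u - 1) * (\sum_(i < n) u ^+ i.+1) = u ^+ n.+1 - u.
  elim: n => [|n IHn]; first by rewrite big_ord0; ring.
  by rewrite big_ord_recr mulrDr IHn /= !exprS; ring.
suff: (u - 1) ^+ 2 * (\sum_(j < m) (u ^+ j.+2 + \sum_(i < j.+1) u ^+ i.+1)) =
  u ^+ m.+3 - u * (u - 1) * m%:R - u ^+ 3.
  by move=> eqG; rewrite mulrDr eqG !exprS; ring.
elim: m => [|m IHm]; first by rewrite big_ord0; ring.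
rewrite big_ord_recr mulrDr IHm /= -(natr1 m).
have -> : (u - 1) ^+ 2 * (u ^+ m.+2 + \sum_(i < m.+1) u ^+ i.+1) =
    (u - 1) ^+ 2 * u ^+ m.+2 + (u - 1) * (u ^+ m.+2 - u) by rewrite -geo; ring.
by rewrite !exprS; ring.
Qed.

Lemma prefix_enumS k :
  (u - 1) ^+ 2 * prefix_enum k.+1 =
  u ^+ 2 * (u ^+ 2 - u + 1) * prefix_enum k
  - u * (u - 1) * (\sum_(w <- words k) dec_prefix w)%:R - u ^+ 3 * (size (words k))%:R.
Proof.
rewrite /prefix_enum /= big_flatten big_map /= mulr_sumr natr_sum.
rewrite (eq_big_seq (fun w => u ^+ 2 * (u ^+ 2 - u + 1) * u ^+ dec_prefix w
   - u * (u - 1) * (dec_prefix w)%:R - u ^+ 3 * 1%:R)) => [|w /mem_words [/doubled_lt w_lt _]].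
  by rewrite !big_split /= !sumrN -!mulr_sumr -sum1_size natr_sum.
by rewrite sum_insertions // kernel_sum mulr1.
Qed.

End Transfer.

(** * Divisibility and cancellation for power series *)

Section Series.
Variable R : comNzRingType.
Implicit Types (f g : fps R) (c : nat -> R).

Lemma coef0_fpsM f g : (f * g) 0%N = f 0%N * g 0%N.
Proof. by rewrite fpsE big_ord1. Qed.

Lemma coef_fpsXM f n : (fpsX * f) n = if n is m.+1 then f m else 0.
Proof.
rewrite fpsE big_ord_recl mul0r add0r; case: n => [|n]; first by rewrite big_ord0.
rewrite big_ord_recl /= mul1r subn1 big1 ?addr0 // => i _.
by rewrite mul0r.
Qed.

Lemma fpsXM_inj : injective (fun f => fpsX * f).
Proof.
move=> f g eq_fg; apply/fpsP => n; have /fpsP/(_ n.+1) := eq_fg.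
by rewrite !coef_fpsXM.
Qed.

(** Coefficient [n] vanishes because of the factor [fpsX ^+ n.+1]. *)
Lemma fps_Xdiv_eq0 f : (forall n, exists g, f = fpsX ^+ n * g) -> f = 0.
Proof.
move=> f_div; apply/fpsP => n; have [g ->] := f_div n.+1.
elim: n {f_div} => [|n IHn]; first by rewrite coef_fpsXM.
by rewrite exprS -mulrA coef_fpsXM IHn.
Qed.

Definition even_fps c : fps R := Fps (fun n => if odd n then 0 else c n./2).

Lemma even_fpsS (c : nat -> nat) k :
  even_fps (fun i => (c (k + i)%N)%:R) =
  (c k)%:R + fpsX ^+ 2 * even_fps (fun i => (c (k.+1 + i)%N)%:R).
Proof.
have natE (n m : nat) : (n%:R : fps R) m = if m is 0%N then n%:R else 0.
  elim: n => [|n IHn]; first by case: m.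
  by rewrite -!natr1 fpsE IHn; case: m {IHn} => [|m] //=; rewrite addr0.
apply/fpsP => n; rewrite expr2 -mulrA fpsE natE.
case: n => [|[|n]]; rewrite !coef_fpsXM /= ?addr0 ?addn0 ?add0r //.
by rewrite negbK addnS.
Qed.

End Series.

Lemma fps_mul_cancel (F : fieldType) (f g h : fps F) :
  f 0%N != 0 -> f * g = f * h -> g = h.
Proof.
move=> f0; have fU : f \is a GRing.unit by [].
by move=> /(congr1 ( *%R f^-1)); rewrite !mulKr.
Qed.

(** * The kernel method *)

Lemma QE : Q = even_fps (fun i => (size (words i))%:R).
Proof. by apply/fpsP => n /=; rewrite op2_123_words. Qed.

(* The series of the derivatives at u = 1 of the polynomials prefix_enum u k. *)
Definition prefix_series : fps rat :=
  even_fps (fun i => (\sum_(w <- words i) dec_prefix w)%:R).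

(** On a zero of the kernel, the recurrence times [fpsX ^+ 2] passes from [A_k(u)] to [A_(k+1)(u)].
    Iterating it replaces the infinite sum of the series [prefix_enum u k * fpsX ^+ (2 * k)]. *)
Lemma kernel_method (u : fps rat) :
  fpsX ^+ 2 * (u ^+ 2 * (u ^+ 2 - u + 1)) = (u - 1) ^+ 2 ->
  (u - 1) ^+ 2 = fpsX ^+ 2 * (u * (u - 1) * prefix_series + u ^+ 3 * Q).
Proof.
move=> ker.
pose Qs k : fps rat := even_fps (fun i => (size (words (k + i)))%:R).
pose Ds k : fps rat := even_fps (fun i => (\sum_(w <- words (k + i)) dec_prefix w)%:R).
(* rest k = x * rest k.+1, so rest 0 is divisible by every power of x. *)
pose rest k := (u - 1) ^+ 2 * prefix_enum u k
   - fpsX ^+ 2 * (u * (u - 1) * Ds k + u ^+ 3 * Qs k).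
have restS k : rest k = fpsX ^+ 2 * rest k.+1.
  rewrite /rest prefix_enumS -{1}ker /Qs /Ds.
  rewrite (even_fpsS _ (fun i => size (words i))).
  rewrite (even_fpsS _ (fun i => \sum_(w <- words i) dec_prefix w)%N).
  by ring.
have rest0 : rest 0%N = 0.
  apply: fps_Xdiv_eq0 => n; exists (fpsX ^+ n * rest n).
  elim: n => [|n IHn]; first by rewrite !expr0 !mul1r.
  by rewrite {1}IHn restS !exprS; ring.
apply/eqP; rewrite -subr_eq0 -rest0 /rest QE /prefix_series /Qs /Ds /=.
by rewrite /prefix_enum big_seq1 expr0 mulr1.
Qed.

(** For [u = 1 / (1 - s)] one has [u - 1 = u * s] and [u ^+ 2 - u + 1 = u ^+ 2 * (1 - w)], so the
    equation for [w] gives that of the kernel. Multiplying by [(1 - s) ^+ 3] then removes [u]. *)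
Lemma kernel_root (s w : fps rat) : s 0%N = 0 -> w = s * (1 - s) ->
  w ^+ 2 = fpsX ^+ 2 * (1 - w) -> s * w = fpsX ^+ 2 * (w * prefix_series + Q).
Proof.
move=> s0 eq_w eq_w2; set x := fpsX ^+ 2 in eq_w2 *.
have sU : 1 - s \is a GRing.unit by rewrite unfold_in /= /fps_unit !fpsE s0 subr0.
pose u := (1 - s)^-1; have us : u * (1 - s) = 1 by rewrite mulVr.
have u1 : u - 1 = u * s by rewrite -[in LHS]us; ring.
have uw : u * w = s by rewrite eq_w mulrCA us mulr1.
have ker : x * (u ^+ 2 * (u ^+ 2 - u + 1)) = (u - 1) ^+ 2.
  have -> : u ^+ 2 - u + 1 = u ^+ 2 * (1 - w).
    have -> : u ^+ 2 * (1 - w) = u ^+ 2 - u * (u * w) by ring.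
    by rewrite uw -u1; ring.
  have -> : x * (u ^+ 2 * (u ^+ 2 * (1 - w))) = u ^+ 4 * (x * (1 - w)) by ring.
  by rewrite -eq_w2 u1 -[in RHS]uw; ring.
have := kernel_method ker; rewrite u1.
move=> /(congr1 ( *%R ((1 - s) ^+ 3))) eqs.
have -> : s * w = (1 - s) ^+ 3 * (u * s) ^+ 2.
  have -> : (1 - s) ^+ 3 * (u * s) ^+ 2 = (u * (1 - s)) ^+ 2 * (s * (s * (1 - s))) by ring.
  by rewrite us expr1n mul1r eq_w.
rewrite eqs.
have -> : (1 - s) ^+ 3 * (x * (u * (u * s) * prefix_series + u ^+ 3 * Q)) =
  x * ((u * (1 - s)) ^+ 2 * (s * (1 - s)) * prefix_series + (u * (1 - s)) ^+ 3 * Q) by ring.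
by rewrite us !expr1n !mul1r eq_w.
Qed.

(** * Elimination between the two roots *)

Theorem theorem3p1 :
  Q = fps_sqrt (2 / (1 + 2 * fpsX ^+ 2 + fps_sqrt (1 - 12 * fpsX ^+ 2))).
Proof.
have coef_nat (n : nat) : (n%:R : fps rat) 0%N = n%:R.
  by elim: n => // n IHn; rewrite -!natr1 fpsE IHn.
have cD (f g : fps rat) : (f + g) 0%N = f 0%N + g 0%N by [].
have cN (f : fps rat) : (- f) 0%N = - f 0%N by [].
have c1 : (1 : fps rat) 0%N = 1 by [].
pose cE := (cD, cN, c1, @coef0_fpsM rat).
have nz2 : (2 : rat) != 0 by [].
have X0 : (fpsX : fps rat) 0%N = 0 by [].
have [x xE] : exists x : fps rat, x = fpsX ^+ 2 by exists (fpsX ^+ 2).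
rewrite -xE.
have x0 : x 0%N = 0 by rewrite xE expr2 coef0_fpsM X0 mulr0.
pose h : fps rat := 2^-1.
have h2 : 2 * h = 1 by rewrite divrr // unfold_in /= /fps_unit coef_nat.
(* w1 and w2 are the two roots of w ^ 2 + x w - x. *)
pose r := fps_sqrt (1 + x * h ^+ 2).
(* As [x = fpsX ^+ 2], a quarter of the discriminant, [x ^+ 2 * h ^+ 2 + x], is the square of
   [fpsX * r]. *)
have r2 : r ^+ 2 = 1 + x * h ^+ 2.
  by rewrite sqr_fps_sqrt // !cE x0 mul0r addr0.
have r0 : r 0%N = 1 by [].
clearbody r h.
pose w1 := fpsX * r - x * h; pose w2 := - (fpsX * r) - x * h.
have w1_0 : w1 0%N = 0 by rewrite !cE X0 x0 !mul0r subr0.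
have w2_0 : w2 0%N = 0 by rewrite !cE X0 x0 !mul0r oppr0 addr0.
have sum_w : w1 + w2 = - x.
  have -> : w1 + w2 = - x * (2 * h) by rewrite /w1 /w2; ring.
  by rewrite h2 mulr1.
have mul_w : w1 * w2 = - x.
  have -> : w1 * w2 = x ^+ 2 * h ^+ 2 - x * r ^+ 2 by rewrite /w1 /w2 xE; ring.
  by rewrite r2; ring.
have w1_2 : w1 ^+ 2 = x * (1 - w1).
  have -> : w1 ^+ 2 = w1 * (w1 + w2) - w1 * w2 by ring.
  by rewrite sum_w mul_w; ring.
have w2_2 : w2 ^+ 2 = x * (1 - w2).
  have -> : w2 ^+ 2 = w2 * (w1 + w2) - w1 * w2 by ring.
  by rewrite sum_w mul_w; ring.
have diff_w : w1 - w2 = fpsX * (2 * r) by rewrite /w1 /w2; ring.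
(* Of the two solutions of [w = s * (1 - s)], [(1 - a) / 2] has the constant coefficient 0 that
   [kernel_root] requires. *)
have half_root (w : fps rat) : w 0%N = 0 ->
    let a := fps_sqrt (1 - 4 * w) in a ^+ 2 = 1 - 4 * w /\
    exists s, [/\ 2 * s = 1 - a, s 0%N = 0 & w = s * (1 - s)].
  move=> w0 a.
  have a2 : a ^+ 2 = 1 - 4 * w.
    by rewrite sqr_fps_sqrt // !cE w0 mulr0 subr0.
  split=> //; exists (h * (1 - a)); split.
  - by rewrite mulrA h2 mul1r.
  - by rewrite !cE subrr mulr0.
  have -> : h * (1 - a) * (1 - h * (1 - a)) =
      h * (1 - a) * (1 - 2 * h) + h ^+ 2 * (1 - a ^+ 2) by ring.
  rewrite h2 a2; have -> : h ^+ 2 * (1 - (1 - 4 * w)) = (2 * h) ^+ 2 * w by ring.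
  by rewrite h2; ring.
have [] := half_root w1 w1_0; set a := fps_sqrt _ => a2 [s [eq_s s0 sw]].
have [] := half_root w2 w2_0; set b := fps_sqrt _ => b2 [t [eq_t t0 tw]].
have a0 : a 0%N = 1 by [].
have b0 : b 0%N = 1 by [].
clearbody w1 w2 a b.
have eq1 : s * w1 = x * (w1 * prefix_series + Q) by rewrite xE; apply: kernel_root; rewrite -?xE.
have eq2 : t * w2 = x * (w2 * prefix_series + Q) by rewrite xE; apply: kernel_root; rewrite -?xE.
(* [eq2] times [w1] minus [eq1] times [w2] eliminates [prefix_series]; the last summand vanishes
   since [w1 * w2 = - x]. *)
have QX : x * (s - t) = x * ((w1 - w2) * Q).
  have -> : x * (s - t) = t * w2 * w1 - s * w1 * w2 + (s - t) * (w1 * w2 + x) by ring.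
  by rewrite mul_w eq1 eq2; ring.
have Qst : s - t = (w1 - w2) * Q.
  by move: QX; rewrite xE expr2 -!mulrA => /fpsXM_inj/fpsXM_inj.
(* [w1 - w2 = (s - t) * (1 - s - t)]. It can be cancelled, being [fpsX] times a series with constant
   coefficient 2. *)
have Q1 : Q * (1 - s - t) = 1.
  have: (w1 - w2) * (Q * (1 - s - t)) = (w1 - w2) * 1.
    by rewrite mulrA -Qst mulr1 sw tw; ring.
  rewrite diff_w -!mulrA => /fpsXM_inj; rewrite !mulrA -[2 * r * Q * _]mulrA.
  by apply: fps_mul_cancel; rewrite coef0_fpsM coef_nat r0.
(* The radicands multiply to [1 + 4 * x - 16 * x]. *)
have ab : a * b = fps_sqrt (1 - 12 * x).
  apply: fps_sqrt_uniq => //; first by rewrite coef0_fpsM a0 b0 mulr1.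
  rewrite exprMn a2 b2.
  have -> : (1 - 4 * w1) * (1 - 4 * w2) = 1 - 4 * (w1 + w2) + 16 * (w1 * w2) by ring.
  by rewrite sum_w mul_w; ring.
rewrite -ab; set den := 1 + 2 * x + a * b.
have den0 : den 0%N = 2.
  by rewrite /den !cE a0 b0 x0.
have denU : den \is a GRing.unit by rewrite unfold_in /= /fps_unit den0.
(* Since [2 * (1 - s - t) = a + b], the claim follows from [(a + b) ^+ 2 = 2 + 4 * x + 2 * (a * b) =
   2 * den]. *)
have den2 : den = 2 * (1 - s - t) ^+ 2.
  apply: (@fps_mul_cancel _ 2); first by rewrite coef_nat.
  have -> : 2 * (2 * (1 - s - t) ^+ 2) = (2 - 2 * s - 2 * t) ^+ 2 :> fps rat by ring.
  rewrite eq_s eq_t.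
  have -> : (2 - (1 - a) - (1 - b)) ^+ 2 = a ^+ 2 + b ^+ 2 + 2 * (a * b) by ring.
  have -> : a ^+ 2 + b ^+ 2 = 2 - 4 * (w1 + w2) by rewrite a2 b2; ring.
  by rewrite sum_w /den; ring.
apply: fps_sqrt_uniq => //.
  have /fpsP/(_ 0%N) := Q1; rewrite !cE s0 t0.
  by rewrite !subr0 mulr1.
apply: (canRL (mulrK denU)); rewrite den2.
have -> : Q ^+ 2 * (2 * (1 - s - t) ^+ 2) = 2 * (Q * (1 - s - t)) ^+ 2 by ring.
by rewrite Q1; ring.
Qed.
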